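(* Let $N\ge 2$ be an integer and let $\alpha\in\mathbb{R}$ with $0<\alpha\le\sqrt N-1$. If $I_\alpha$ consists of five or more cylinder sets (i.e. at least five of the sets $\Delta_i$ are non-empty), then $I_\alpha$ has no gaps.
   Context: For an integer $N\ge 2$ and a real $\alpha$ with $0<\alpha\le\sqrt N-1$, put $I_\alpha=[\alpha,\alpha+1]$. Define the digit function $d:I_\alpha\to\mathbb{N}$ by $d(x)=\lfloor N/x-\alpha\rfloor$ if $x\in(\alpha,\alpha+1]$, or if $x=\alpha$ and $N/\alpha-\alpha\notin\mathbb{Z}$; and $d(\alpha)=\lfloor N/\alpha-\alpha\rfloor-1$ if $N/\alpha-\alpha\in\mathbb{Z}$. The $N$-expansion map $T_\alpha:I_\alpha\to I_\alpha$ is $T_\alpha(x)=N/x-d(x)$. The cylinder sets are $\Delta_i=\{x\in I_\alpha: d(x)=i\}$, which are non-empty exactly for $d(\alpha+1)\le i\le d(\alpha)$; $I_\alpha$ is their disjoint union. A gap of $I_\alpha$ is a (non-empty) open interval $(a,b)\subset I_\alpha$ that is maximal with respect to the property: for Lebesgue-almost every $x\in I_\alpha$ there is $n_0\in\mathbb{N}$ such that $T_\alpha^n(x)\notin(a,b)$ for all $n\ge n_0$. *)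

(* Defs.v *)
From HB Require Import structures.
From mathcomp Require Import all_boot all_order all_algebra.
From mathcomp Require Import all_classical all_reals all_analysis.
Set Implicit Arguments.
Unset Strict Implicit.
Unset Printing Implicit Defensive.
Import Order.TTheory GRing.Theory Num.Theory.
Import numFieldNormedType.Exports.
Local Open Scope classical_set_scope.
Local Open Scope ring_scope.

Section NExpansion.
Context {R : realType}.
Implicit Types (N : nat) (alpha x a b : R).

Definition Ialpha alpha : set R := `[alpha, alpha + 1]%classic.

(* The digit and the map are total functions on R; only their values on
   [Ialpha alpha] are meaningful.  For 0 < alpha <= sqrt N - 1 the digits on
   [Ialpha alpha] are positive, so taking them in [int] rather than in [nat]
   adds no digit. *)
Definition digit N alpha x : int :=
  if (x == alpha) && (N%:R / alpha - alpha \is a Num.int)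
  then Num.floor (N%:R / alpha - alpha) - 1
  else Num.floor (N%:R / x - alpha).

Definition Tmap N alpha x : R := N%:R / x - (digit N alpha x)%:~R.

Definition cylinder N alpha (i : int) : set R :=
  [set x | Ialpha alpha x /\ digit N alpha x = i].

Definition eventually_avoided N alpha a b : Prop :=
  {ae (@lebesgue_measure R), forall x, Ialpha alpha x ->
    exists n0 : nat, forall n : nat, (n0 <= n)%N ->
      ~ `]a, b[%classic (iter n (Tmap N alpha) x)}.

Definition is_gap N alpha a b : Prop :=
  [/\ a < b,
      `]a, b[%classic `<=` Ialpha alpha,
      eventually_avoided N alpha a b
    & forall a' b' : R,
        `]a', b'[%classic `<=` Ialpha alpha ->
        eventually_avoided N alpha a' b' ->
        `]a, b[%classic `<=` `]a', b'[%classic ->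
        `]a', b'[%classic = `]a, b[%classic ].

End NExpansion.

(* Main.v *)
Require Import Defs.
From HB Require Import structures.
From mathcomp Require Import all_boot all_order all_algebra.
From mathcomp Require Import all_classical all_reals all_analysis.
From mathcomp Require Import measurable_realfun ring lra zify.
Import Order.TTheory GRing.Theory Num.Theory.
Import numFieldNormedType.Exports.
Local Open Scope classical_set_scope.
Local Open Scope ring_scope.
Set Implicit Arguments.
Unset Strict Implicit.
Unset Printing Implicit Defensive.

(** An open interval inside [a, a + 1], called the target below, is never
    eventually avoided by almost every orbit; this is more than the absence of
    gaps.  Fix [n] and let [A] be the set of the points whose orbit avoids the
    target from time [n] on.  It is forward invariant, and it suffices to show
    that it is null, since the points that eventually avoid the target form the
    union over [n] of these sets.

    Topology.  Call an interval dense when [A] is dense in it.  A branch of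
    the map sends dense intervals to dense intervals, and the whole
    interval is not dense, because some preimage of the target contains an
    interval missed by [A].  A cylinder that is not extreme is mapped onto the
    whole interval, so a dense interval contains none, hence meets at most two
    cylinders.  If it lies in one of them its image is longer by a factor 21/20.
    If it is cut into two, one compares the images of both halves; five
    cylinders force slopes so large that one image is again longer by 21/20,
    except when the cut is at the left end of the last cylinder, where the
    slope may be close to 1 on the right.  There the image of the left half
    starts at [a], in the region of large slopes, and if it is not long enough
    one of its own images is.  So a single dense interval would give dense
    intervals of unbounded length ([growth_step], [dense_on_grows]): there is
    none, and every interval of length at least [dl] contains a hole of [A] of
    length at least some [eta] depending only on [dl] ([uniform_hole]).

    Measure.  The inverse branches of the iterates are Moebius maps
    [(p z + q) / (k z + l)] with nonnegative coefficients, and these have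
    distortion at most [((a + 1) / a) ^ 2] on [a, a + 1], uniformly in the
    number of iterations ([nonneg_mobius_distortion]).  The 30th iterate
    expands by more than 4 and is continuous off a finite set, so a short
    interval is cut into at most two pieces by this iterate.  Pull an interval
    forward in this way until the pieces are long.  A long piece has a hole,
    which is pulled back to a definite proportion of the original piece, and at
    each step the bound on the total length of what is still short is halved.
    Hence [A] fills at most a proportion [1 - g < 1] of every interval
    ([inverse_branch_sparse]), and covering [A] efficiently by intervals shows
    that it is null ([outer_measure_eq0]). *)

(** * Slopes forced by five cylinders *)

(** The inequalities say that [d] and [D] are the digits at the right and left
    ends of the interval.  For [D] the strict and the weak inequality
    are exchanged because a point just to the right of [a] has digit [D]
    also when [N / a - a] is the integer [D + 1]. *)
Record digit_bounds (R : realFieldType) (N a : R) (d D : nat) : Prop := DigitBounds {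
  db_a : 0 < a;
  db_N : 2 <= N;
  db_d : (1 <= d)%N;
  db_dD : (d + 4 <= D)%N;
  db_dl : (d%:R + a) * (a + 1) <= N;
  db_du : N < (d%:R + 1 + a) * (a + 1);
  db_Dl : (D%:R + a) * a < N;
  db_Du : N <= (D%:R + 1 + a) * a }.

Section Growth.
Context (R : realFieldType).
Implicit Types (N a c e : R) (d D i : nat).

(** The mean slope of [N / x] between [c] and [e] is [N / (c e)]. *)
Lemma inv_stretch N c e c' e' : 0 < N -> 0 < c -> c <= e -> c <= c' -> e <= e' ->
  N / (c' * e') * (e - c) <= N / c - N / e.
Proof.
move=> N0 c0 ce cc ee.
have e0 : 0 < e by lra.
have c'0 : 0 < c' by lra.
have e'0 : 0 < e' by lra.
have -> : N / c - N / e = N / (c * e) * (e - c) by field; rewrite !gt_eqF.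
rewrite ler_wpM2r ?subr_ge0// ler_wpM2l ?(ltW N0)// lef_pV2 ?posrE ?mulr_gt0//.
by rewrite ler_pM// ltW.
Qed.

Lemma db_small N a d D : digit_bounds N a d D -> 2 * a < d%:R + 1.
Proof.
case=> a0 N2 d1 dD dl du Dl Du.
have d1' : (1 : R) <= d%:R by rewrite ler1n.
have dD' : (d%:R + 4 : R) <= D%:R by rewrite -natrD ler_nat.
have : (d%:R + 4 + a) * a < (d%:R + 1 + a) * (a + 1) by nra.
nra.
Qed.

(** This bounds below the slope [N / (a + 1) ^ 2] at the right endpoint, where it
    is smallest.  The margin is thin: for [N = 2] and [a] near 0.372 the slope
    is about 1.06. *)
Lemma min_slope N a d D : digit_bounds N a d D ->
  21 / 20 * (a + 1) ^+ 2 <= N.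
Proof.
move=> h; have h2 := db_small h.
case: h => a0 N2 d1 dD dl du Dl Du.
have d1' : (1 : R) <= d%:R by rewrite ler1n.
have dD' : (d%:R + 4 : R) <= D%:R by rewrite -natrD ler_nat.
have N5 : a ^+ 2 + 5 * a < N by nra.
have N3 : 3 * a ^+ 2 + 3 * a < N by nra.
(* [2 <= N] settles small [a], the two quadratic bounds the others *)
case: (lerP a (37/100)) => h3; nra.
Qed.

(** Dividing by [z * (z + 1) ^ 2], this compares [20 / 21] with the sum of
    the reciprocals of the slopes on the two sides of [N / (z + 1)]. *)
Lemma split_ineq (N a d z : R) : 0 < a -> 1 <= d -> 2 * a < d + 1 ->
  N < (d + 1 + a) * (a + 1) -> d + 1 + a <= z ->
  N * (2 * z + 1) < 20 / 21 * (z * (z + 1) ^+ 2).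
Proof.
move=> a0 d1 h2 du dz.
have h1 : (a + 1) * (2 * (d + 1 + a) + 1) < 20 / 21 * (d + 1 + a + 1) ^+ 2 by nra.
have h3 : (a + 1) * (2 * z + 1) < 20 / 21 * (z + 1) ^+ 2.
  have : 0 <= (z - (d + 1 + a)) * (20 / 21 * (z + 1 + d + 1 + a + 1) - 2 * (a + 1)).
    by apply: mulr_ge0; lra.
  nra.
have z0 : 0 < z by lra.
have : N * (2 * z + 1) < z * (a + 1) * (2 * z + 1).
  by rewrite ltr_pM2r; [nra|lra].
nra.
Qed.

(** Here [(d + 1 + a) / (a + 1)] bounds below the slope at the left end of the
    last cylinder, and the two fractions on the left bound above the reciprocals
    of the slopes on the first two cylinders.  The factors of these terms are
    replaced by their values or bounds at [a = (d + 1) / 2], [D = d + 4], which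
    leaves an inequality in [d] alone. *)
Lemma last_split_ineq (a d D : R) : 0 < a -> 1 <= d -> 2 * a < d + 1 -> d + 4 <= D ->
  1 + a / (D + a) + a * (D + 1 + a) / ((D + a) * (D - 1 + a))
   < 20 / 21 * ((d + 1 + a) / (a + 1)).
Proof.
move=> a0 d1 h2 dD.
have frac_le (x y z t : R) : 0 < y -> 0 < t -> x * t <= z * y -> x / y <= z / t.
  by move=> y0 t0; rewrite ler_pdivrMr// mulrAC ler_pdivlMr.
have e1 : a / (D + a) <= (d + 1) / (3 * d + 9).
  apply: frac_le; [lra|lra|].
  have : 0 <= (d + 1) * (D - d - 4) + (d + 4) * (d + 1 - 2 * a) by apply: addr_ge0; apply: mulr_ge0; lra.
  lra.
have e2 : (D + 1 + a) / (D + a) <= 6 / 5 by apply: frac_le; lra.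
have e3 : a / (D - 1 + a) <= (d + 1) / (3 * d + 7).
  apply: frac_le; [lra|lra|].
  have : 0 <= (d + 1) * (D - d - 4) + (d + 3) * (d + 1 - 2 * a) by apply: addr_ge0; apply: mulr_ge0; lra.
  lra.
have e4 : 2 / (d + 3) <= 1 / (a + 1) by apply: frac_le; lra.
rewrite div1r in e4.
have -> : a * (D + 1 + a) / ((D + a) * (D - 1 + a)) =
   ((D + 1 + a) / (D + a)) * (a / (D - 1 + a)).
  by field; rewrite !gt_eqF; lra.
have e5 : ((D + 1 + a) / (D + a)) * (a / (D - 1 + a)) <= 6 / 5 * ((d + 1) / (3 * d + 7)).
  apply: ler_pM => //; apply: divr_ge0; lra.
have -> : (d + 1 + a) / (a + 1) = 1 + d * (a + 1)^-1 by field; rewrite gt_eqF; lra.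
have e6 : 1 + (d + 1) / (3 * d + 9) + 6 / 5 * ((d + 1) / (3 * d + 7))
   < 20 / 21 * (1 + d * (2 / (d + 3))).
  rewrite -subr_gt0.
  have -> : 20 / 21 * (1 + d * (2 / (d + 3))) -
      (1 + (d + 1) / (3 * d + 9) + 6 / 5 * ((d + 1) / (3 * d + 7))) =
      (20 / 21 * (3 * d + 3) * 15 * (3 * d + 7) - 15 * (d + 3) * (3 * d + 7)
       - 5 * (d + 1) * (3 * d + 7) - 18 * (d + 1) * (d + 3))
      / (15 * (d + 3) * (3 * d + 7)).
    by field; rewrite !gt_eqF; lra.
  apply: divr_gt0; nra.
nra.
Qed.

Lemma two_halves_short (N z l x y : R) : 0 < z -> 0 < l ->
  N * (2 * z + 1) < 20 / 21 * (z * (z + 1) ^+ 2) ->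
  (z + 1) ^+ 2 * x < l * N -> (z + 1) * z * y < l * N -> 21 / 20 * (x + y) < l.
Proof.
move=> z0 l0 h x1 y1; have z1 : 0 < z + 1 by rewrite addr_gt0.
have k1 : z * ((z + 1) ^+ 2 * x) < z * (l * N) by rewrite ltr_pM2l.
have k2 : (z + 1) * ((z + 1) * z * y) < (z + 1) * (l * N) by rewrite ltr_pM2l.
have k3 : l * (N * (2 * z + 1)) < l * (20 / 21 * (z * (z + 1) ^+ 2)) by rewrite ltr_pM2l.
have k4 : 0 < z * (z + 1) ^+ 2 by rewrite mulr_gt0// exprn_gt0.
rewrite -(ltr_pM2r k4); lra.
Qed.

Lemma last_halves_short (g g' u l s x y : R) : 0 < u -> 0 < l ->
  1 + g + g' < 20 / 21 * u ->
  s <= l * (g + g') -> u * x <= s -> u * y < l -> 21 / 20 * (x + y) < l.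
Proof.
move=> u0 l0 h s1 x1 y1.
have k : l * (1 + g + g') < l * (20 / 21 * u) by rewrite ltr_pM2l.
rewrite -(ltr_pM2r u0); lra.
Qed.

(** * Lengthening an interval by one application of the map *)

(** The boundaries [N / (i + a)] of the cylinders decrease as [i] grows; the
    digit is the least [i] for which the next boundary is at most [c]. *)
Lemma locate_digit N a d D c : digit_bounds N a d D -> a <= c -> c < a + 1 ->
  exists i, [/\ (d <= i <= D)%N, N / (i.+1%:R + a) <= c & c < N / (i%:R + a)].
Proof.
move=> [a0 N2 d1 dD dl du Dl Du] ac ca.
have c0 : 0 < c by lra.
pose P i := N <= c * (i.+1%:R + a).
have PD : P D by rewrite /P -natr1; nra.
have exP : exists i, P i by exists D.
case: (ex_minnP exP) => i Pi imin; exists i.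
have ia j : 0 < j%:R + a by have := ler0n R j; lra.
have di : (d <= i)%N.
  rewrite leqNgt; apply/negP => id.
  have : (i.+1%:R : R) <= d%:R by rewrite ler_nat.
  move: Pi; rewrite /P => Pi id'.
  have d0 := ia d; nra.
split; first by rewrite di imin.
  by rewrite ler_pdivrMr.
rewrite ltr_pdivlMr//; move: di; rewrite leq_eqVlt => /orP[/eqP<-|].
  have d0 := ia d; nra.
case: i Pi imin => // i Pi imin _; rewrite ltNge; apply/negP => /imin.
by rewrite ltnn.
Qed.

(** [B] stands for a family of intervals stable under subintervals and under
    the branches of the map; it will be instantiated with the intervals on
    which a given forward invariant set is dense. *)
Section GrowthStep.
Variables (N a : R) (d D : nat) (B : R -> R -> Prop).
Hypothesis bnd : digit_bounds N a d D.
Hypothesis B_dom : forall c e, B c e -> [/\ a <= c, c < e & e <= a + 1].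
Hypothesis B_mono : forall c e c' e',
  B c e -> c <= c' -> c' < e' -> e' <= e -> B c' e'.
Hypothesis B_push : forall i c e, (d <= i <= D)%N -> B c e ->
  N / (i.+1%:R + a) <= c -> e <= N / (i%:R + a) ->
  B (N / e - i%:R) (N / c - i%:R).

Let p i : R := N / (i%:R + a).

Let N0 : 0 < N. Proof. by have := db_N bnd; lra. Qed.
Let a0 : 0 < a. Proof. exact: db_a bnd. Qed.
Let ia i : 0 < i%:R + a. Proof. by have := ler0n R i; have := a0; lra. Qed.
Let p0 i : 0 < p i. Proof. by rewrite divr_gt0. Qed.
Let Np i : N / p i = i%:R + a.
Proof. by rewrite /p; field; rewrite !gt_eqF. Qed.
Let p_lt i j : (i < j)%N -> p j < p i.
Proof. by move=> ij; rewrite ltr_pM2l// ltf_pV2 ?posrE// ltrD2r ltr_nat. Qed.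

(** [growth_step] is proved by contradiction; [l] is the length it claims to reach. *)
Section BoundedLength.
Variable l : R.
Hypothesis l0 : 0 < l.
Hypothesis short : forall c e, B c e -> e - c < l.
Hypothesis not_whole : ~ B a (a + 1).

Lemma short_image i c e : (d <= i <= D)%N -> B c e ->
  p i.+1 <= c -> e <= p i -> N / c - N / e < l.
Proof. by move=> iD B' h h'; have := short (B_push iD B' h h'); lra. Qed.

(** A cylinder strictly between the extreme ones is mapped onto everything. *)
Lemma no_full_cylinder i : (d < i < D)%N -> ~ B (p i.+1) (p i).
Proof.
move=> /andP[di iD] Bi; apply: not_whole.
have := @B_push i _ _ _ Bi (lexx _) (lexx _); rewrite (ltnW di) (ltnW iD).
by move=> /(_ isT); rewrite !Np -natr1; congr B; ring.
Qed.

Lemma cylinder_short i c e : (d <= i <= D)%N -> B c e -> p i.+1 <= c -> e <= p i ->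
  21 / 20 * (e - c) < l.
Proof.
move=> iD Bce pc ep; have [ac ce ea] := B_dom Bce.
apply: le_lt_trans (short_image iD Bce pc ep).
have c0 : 0 < c := lt_le_trans a0 ac.
apply: le_trans (inv_stretch N0 c0 (ltW ce) (ltW (lt_le_trans ce ea)) ea).
rewrite ler_wpM2r ?subr_ge0 ?(ltW ce)// ler_pdivlMr.
  by rewrite -expr2; exact: min_slope bnd.
by have := a0; nra.
Qed.

(** Both halves of an interval cut at the boundary [p i.+1] are stretched by
    the slopes there, and [split_ineq] says that the sum of the reciprocals
    of these two slopes is too small for both images to be short. *)
Lemma split_short i c e : (d < i)%N -> (i < D)%N -> B c e ->
  p i.+2 <= c -> c < p i.+1 -> p i.+1 < e -> e <= p i ->
  21 / 20 * (e - c) < l.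
Proof.
move=> di iD Bce pc cp pe ep; have [ac _ ea] := B_dom Bce.
have c0 : 0 < c := lt_le_trans a0 ac.
have q0 := p0 i.+1; set q := p i.+1 in cp pe q0.
have [Bl Br] : B c q /\ B q e by split; apply: B_mono Bce _ _ _ => //; exact: ltW.
have sl : N / c - N / q < l by apply: (@short_image i.+1) => //; rewrite iD ltnW// ltnW.
have sr : N / q - N / e < l by apply: (@short_image i) => //; rewrite (ltnW di) ltnW.
have z0 := ia i; set z := i%:R + a in z0.
have z1 : 0 < z + 1 by rewrite addr_gt0.
have Eq : q = N / (z + 1) by rewrite /q /p -natr1 addrAC.
have dz : d%:R + 1 + a <= z by rewrite lerD2r natr1 ler_nat.
have d1 : (1 : R) <= d%:R by rewrite ler1n (db_d bnd).
have hz := split_ineq a0 d1 (db_small bnd) (db_du bnd) dz.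
have x1 : (z + 1) ^+ 2 / N * (q - c) < l.
  apply: le_lt_trans sl; apply: le_trans (inv_stretch N0 c0 (ltW cp) (ltW cp) (lexx q)).
  rewrite Eq le_eqVlt; apply/orP; left.
  by apply/eqP; congr (_ * _); field; rewrite !gt_eqF.
have y1 : (z + 1) * z / N * (e - q) < l.
  apply: le_lt_trans sr; apply: le_trans (inv_stretch N0 q0 (ltW pe) (lexx q) ep).
  rewrite Eq le_eqVlt; apply/orP; left.
  by apply/eqP; congr (_ * _); rewrite /p -/z; field; rewrite !gt_eqF.
have -> : e - c = (q - c) + (e - q) by ring.
move: x1 y1; rewrite ![_ / N * _]mulrAC !ltr_pdivrMr//.
exact: two_halves_short z0 l0 hz.
Qed.

(** Near the left endpoint the slope is large, so an interval of the family
    that starts at [a] is much shorter than [l].  It need not stay inside the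
    first cylinder, but it cannot contain the second one; the two terms of the
    bound are the contributions of these two cylinders. *)
Lemma left_end_short s : 0 < s -> B a (a + s) ->
  s <= l * (a / (D%:R + a) + a * (D%:R + 1 + a) / ((D%:R + a) * (D%:R - 1 + a))).
Proof.
move=> s0 Bs; have [_ N2 _ dD _ _ Dl Du] := bnd.
have D1 : p D.+1 <= a by rewrite ler_pdivrMr// -natr1 mulrC.
have aD : a < p D by rewrite ltr_pdivlMr// mulrC.
have dDD : (d <= D <= D)%N by rewrite leqnn andbT (leq_trans _ dD)// leq_addr.
have D4 : (4 : R) <= D%:R by rewrite (ler_nat _ 4) (leq_trans _ dD)// leq_addl.
have as0 : a < a + s by rewrite ltrDl.
set A := (D%:R + a) / a.
have A0 : 0 < A by rewrite divr_gt0.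
have EA : N / (a * p D) = A by rewrite /A /p; field; rewrite !gt_eqF.
have [gm|mg] := lerP (a + s) (p D).
  have h3 := short_image dDD Bs D1 gm.
  have := le_lt_trans (inv_stretch N0 a0 (ltW as0) (lexx a) gm) h3.
  rewrite EA (addrC a) addrK mulrC -ltr_pdivlMr// => /ltW /le_trans; apply.
  rewrite ler_wpM2l ?(ltW l0)// invf_div lerDl divr_ge0 ?mulr_ge0 ?(ltW a0)//;
    have := a0; lra.
have Bm : B a (p D) by apply: B_mono Bs _ _ _ => //; exact: ltW.
have Bg : B (p D) (a + s) by apply: B_mono Bs _ _ _ => //; exact: ltW.
have t1 : p D - a <= l * (a / (D%:R + a)).
  have := le_lt_trans (inv_stretch N0 a0 (ltW aD) (lexx a) (lexx (p D)))
    (short_image dDD Bm D1 (lexx _)).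
  by rewrite EA mulrC -ltr_pdivlMr// invf_div => /ltW.
have [D' ED] : exists D', D = D'.+1.
  by exists D.-1; rewrite prednK// (leq_trans _ dD)// addn4.
have dD1 : (d < D')%N by move: dD; rewrite ED addn4 ltnS => /ltnW /ltnW.
have ED1 : D%:R - 1 = D'%:R :> R by rewrite ED -natr1 addrK.
have gD : a + s <= p D'.
  rewrite leNgt; apply/negP => gD.
  have : (d < D' < D)%N by rewrite dD1 ED /=.
  move=> /no_full_cylinder; apply; rewrite -ED; apply: B_mono Bg _ _ (ltW gD) => //.
  by apply: p_lt; rewrite ED.
have dD1' : (d <= D' <= D)%N by rewrite (ltnW dD1) ED/=.
have t2 : (D%:R + a) * (D'%:R + a) / N * (a + s - p D) < l.
  apply: le_lt_trans (short_image dD1' Bg _ gD); last by rewrite ED.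
  apply: le_trans (inv_stretch N0 (p0 D) (ltW mg) (lexx _) gD).
  rewrite le_eqVlt; apply/orP; left; apply/eqP; congr (_ * _).
  by rewrite /p; field; rewrite !gt_eqF.
have t3 : a + s - p D <= l * (a * (D%:R + 1 + a) / ((D%:R + a) * (D%:R - 1 + a))).
  have DD0 : 0 < (D%:R + a) * (D'%:R + a) by rewrite mulr_gt0.
  move: t2; rewrite mulrC -ltr_pdivlMr ?divr_gt0// invf_div => /ltW /le_trans; apply.
  by rewrite ler_wpM2l ?(ltW l0)// ED1 ler_pM2r ?invr_gt0// mulrC.
rewrite mulrDr; apply: le_trans (lerD t1 t3); rewrite le_eqVlt; apply/orP; left.
by apply/eqP; ring.
Qed.

(** At the left end of the last cylinder the slopes alone do not suffice: they
    may be close to 1 on the right.  But the image of the left half starts at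
    [a], where [left_end_short] gives a second, strong expansion. *)
Lemma last_split_short c e : B c e ->
  p d.+2 <= c -> c < p d.+1 -> p d.+1 < e -> 21 / 20 * (e - c) < l.
Proof.
move=> Bce pc cp pe; have [ac _ ea] := B_dom Bce.
have [_ N2 d1' dD dl du _ _] := bnd.
have c0 : 0 < c := lt_le_trans a0 ac.
have q0 := p0 d.+1; set q := p d.+1 in cp pe q0.
have [Bl Br] : B c q /\ B q e by split; apply: B_mono Bce _ _ _ => //; exact: ltW.
have dD2 : (d.+1 <= D)%N by rewrite (leq_trans _ dD)// -addn1 leq_add2l.
have ep : e <= p d by apply: le_trans ea _; rewrite ler_pdivlMr// mulrC.
have sr : N / q - N / e < l by apply: (@short_image d) => //; rewrite leqnn ltnW.
have w0 : 0 < a + 1 by rewrite addr_gt0.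
have v0 := ia d.+1.
have Ev : d.+1%:R + a = d%:R + 1 + a by rewrite -natr1.
rewrite -Ev in du; set v := d.+1%:R + a in v0 Ev du.
have Eq : q = N / v by [].
have y1 : v / (a + 1) * (e - q) < l.
  apply: le_lt_trans sr; apply: le_trans (inv_stretch N0 q0 (ltW pe) (lexx q) ea).
  rewrite Eq le_eqVlt; apply/orP; left.
  by apply/eqP; congr (_ * _); field; rewrite !gt_eqF.
set s := N / c - N / q.
have x1 : v / (a + 1) * (q - c) <= s.
  apply: le_trans (inv_stretch N0 c0 (ltW cp) (ltW cp) (lexx q)).
  rewrite Eq ler_wpM2r//; first by rewrite -Eq subr_ge0 ltW.
  have -> : N / (N / v * (N / v)) = v * (v / N) by field; rewrite !gt_eqF.
  by rewrite ler_pM2l// ler_pdivlMr// mulrC ler_pdivrMr// ltW.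
have s0 : 0 < s by apply: lt_le_trans x1; rewrite mulr_gt0 ?divr_gt0 ?subr_gt0.
have Bs : B a (a + s).
  have := @B_push d.+1 c q; rewrite dD2 leqnSn/= => /(_ isT Bl pc (lexx _)).
  have -> : N / q - d.+1%:R = a by rewrite Np addrAC subrr add0r.
  by congr B; rewrite /s Np; ring.
have s1 := left_end_short s0 Bs.
have d1 : (1 : R) <= d%:R by rewrite ler1n.
have dD' : (d%:R + 4 : R) <= D%:R by rewrite -natrD ler_nat.
have hu := last_split_ineq a0 d1 (db_small bnd) dD'; rewrite -Ev -/v in hu.
have u0 : 0 < v / (a + 1) by rewrite divr_gt0.
have -> : e - c = (q - c) + (e - q) by ring.
exact: last_halves_short u0 l0 hu s1 x1 y1.
Qed.

Lemma no_growth c e : B c e -> 21 / 20 * (e - c) < l.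
Proof.
move=> Bce; have [ac ce ea] := B_dom Bce.
have [i [/andP[di iD] pc cp]] := locate_digit bnd ac (lt_le_trans ce ea).
have [ep|pe] := lerP e (p i).
  by apply: (@cylinder_short i) => //; rewrite di.
have epd : e <= p d.
  by apply: le_trans ea _; rewrite ler_pdivlMr// mulrC (db_dl bnd).
have {}di : (d < i)%N.
  rewrite ltn_neqAle di andbT; apply/eqP => dE.
  by move: pe; rewrite ltNge -dE epd.
case: i di iD pc cp pe => // i; rewrite ltnS => di iD pc cp pe.
move: di pc cp pe; rewrite leq_eqVlt => /orP[/eqP <-|di] pc cp pe.
  exact: last_split_short.
apply: (@split_short i) => //; rewrite leNgt; apply/negP => pe2.
apply: (@no_full_cylinder i); first by rewrite di.
apply: B_mono Bce _ _ (ltW pe2); first exact: ltW.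
exact: p_lt.
Qed.
End BoundedLength.

Lemma growth_step c e : B c e ->
  B a (a + 1) \/ exists c' e', B c' e' /\ 21 / 20 * (e - c) <= e' - c'.
Proof.
move=> Bce; have [_ ce _] := B_dom Bce.
apply: contrapT => /not_orP[nB nG].
have l0 : 0 < 21 / 20 * (e - c) by lra.
have short c' e' : B c' e' -> e' - c' < 21 / 20 * (e - c).
  by move=> B'; rewrite ltNge; apply/negP => h; apply: nG; exists c', e'.
by have := no_growth l0 short nB Bce; rewrite ltxx.
Qed.
End GrowthStep.
End Growth.

(** * Inverse branches have bounded distortion *)

Section Branches.
Context (R : realType).
Implicit Types (c e z x : R) (M : R -> R).

(** The difference quotient determines a Moebius map with denominator
    [k z + l] up to an additive constant, and it is the only information used
    about its numerator. *)
Definition nonneg_mobius M : Prop := exists k l delta : R,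
  [/\ 0 <= k, 0 <= l, 0 < k + l &
      forall z z', 0 < z -> 0 < z' ->
        M z - M z' = delta * (z - z') / ((k * z + l) * (k * z' + l))].

Lemma nonneg_mobius_id : nonneg_mobius id.
Proof.
exists 0, 1, 1; split; rewrite ?add0r// => z z' z0 z'0.
by rewrite !mul0r !add0r !mul1r divr1.
Qed.

Lemma nonneg_mobius_inv M (N : R) i : 0 < N -> nonneg_mobius M ->
  nonneg_mobius (fun z => M (N / (i%:R + z))).
Proof.
move=> N0 [k [l [dl [k0 l0 kl H]]]].
have i0 : (0 : R) <= i%:R by [].
exists l, (k * N + l * i%:R), (- dl * N); split => //.
- by rewrite addr_ge0// mulr_ge0// ltW.
- have := mulr_ge0 k0 (ltW N0); have := mulr_ge0 l0 i0.
  move: l0; rewrite le_eqVlt => /orP[/eqP l0|]; last by lra.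
  have : 0 < k * N by rewrite mulr_gt0//; lra.
  lra.
have den_gt0 z : 0 < z -> 0 < l * z + (k * N + l * i%:R).
  move=> z0; have := mulr_ge0 l0 i0.
  move: l0; rewrite le_eqVlt => /orP[/eqP l0 _|l0 _].
    have : 0 < k * N by rewrite mulr_gt0//; lra.
    by rewrite -l0 !mul0r; lra.
  have := mulr_gt0 l0 z0; have := mulr_ge0 k0 (ltW N0).
  have := mulr_ge0 (ltW l0) i0; lra.
move=> z z' z0 z'0.
have iz : 0 < i%:R + z by rewrite ltr_wpDl.
have iz' : 0 < i%:R + z' by rewrite ltr_wpDl.
rewrite H ?divr_gt0//; field.
have := den_gt0 z z0; have := den_gt0 z' z'0 => d' d.
by rewrite !gt_eqF.
Qed.

(** A Moebius map without a pole on the positive reals is monotone there. *)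
Lemma nonneg_mobius_between M c m e : nonneg_mobius M ->
  0 < c -> c <= m -> m <= e -> `|M e - M c| = `|M e - M m| + `|M m - M c|.
Proof.
move=> [k [l [dl [k0 l0 kl H]]]] c0 cm me.
have m0 : 0 < m by lra. have e0 : 0 < e by lra.
have den_ge0 z : 0 < z -> 0 <= (k * z + l)^-1.
  by move=> z0; rewrite invr_ge0 addr_ge0// mulr_ge0// ltW.
have [d0|d0] := lerP 0 dl.
  have mon u v : 0 < u -> u <= v -> 0 <= M v - M u.
    move=> u0 uv; have v0 : 0 < v by lra.
    by rewrite H// invfM !mulr_ge0 ?den_ge0// subr_ge0.
  rewrite !ger0_norm; [by ring|exact: mon..|apply: mon => //; lra].
have mon u v : 0 < u -> u <= v -> M v - M u <= 0.
  move=> u0 uv; have v0 : 0 < v by lra.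
  by rewrite H// invfM !mulr_le0_ge0 ?mulr_ge0 ?den_ge0// ?(ltW d0)// subr_ge0.
rewrite !ler0_norm; [by ring|exact: mon..|apply: mon => //; lra].
Qed.

(** The pole is at most 0, so the derivative, proportional to
    [(k z + l) ^ -2], varies by a factor at most [((a + 1) / a) ^ 2]; the bound
    is independent of [k] and [l]. *)
Lemma nonneg_mobius_distortion M (a c c' e' e : R) : 0 < a -> nonneg_mobius M ->
  a <= c -> c <= c' -> c' <= e' -> e' <= e -> e <= a + 1 ->
  (e' - c') * (a / (a + 1)) ^+ 2 * `|M e - M c| <= `|M e' - M c'|.
Proof.
move=> a0 [k [l [dl [k0 l0 kl H]]]] ac cc' ce' ee' ea.
have den_gt0 z : 0 < z -> 0 < k * z + l.
  move=> z0; have := mulr_ge0 k0 (ltW z0).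
  move: l0; rewrite le_eqVlt => /orP[/eqP l0|]; last by lra.
  by have : 0 < k * z by [rewrite mulr_gt0//; lra|]; lra.
rewrite !H; try lra.
rewrite !normrM !normfV !normrM.
have nz z : 0 < z -> `|k * z + l| = k * z + l by move=> /den_gt0 /gtr0_norm.
rewrite !nz; try lra.
rewrite (ger0_norm (_ : 0 <= e - c)) ?(ger0_norm (_ : 0 <= e' - c')) ?subr_ge0//; last by lra.
set Q := k * a + l.
have Q0 : 0 < Q by apply: den_gt0.
have D1 z : a <= z -> Q <= k * z + l by move=> az; rewrite lerD2r ler_wpM2l.
have D2 z : z <= a + 1 -> 0 < z -> (k * z + l)^-1 >= a / (a + 1) * Q^-1.
  move=> za z0; have d0 := den_gt0 _ z0.
  have aQ0 : 0 < (a + 1) * Q by rewrite mulr_gt0//; lra.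
  rewrite -mulrA -invfM -[leRHS]div1r ler_pdivrMr// mulrAC ler_pdivlMr// mul1r /Q.
  have : k * a * z <= k * a * (a + 1) by rewrite ler_wpM2l// mulr_ge0// ltW.
  have := mulr_ge0 l0 (ltW a0).
  lra.
have D3 z : a <= z -> 0 <= (k * z + l)^-1.
  by move=> az; rewrite invr_ge0 ltW// den_gt0//; lra.
have D4 z : a <= z -> (k * z + l)^-1 <= Q^-1.
  by move=> az; rewrite lef_pV2 ?posrE ?D1// den_gt0//; lra.
have i1 : ((k * e + l) * (k * c + l))^-1 <= Q^-1 * Q^-1.
  by rewrite invfM; apply: ler_pM; (apply: D3 || apply: D4); lra.
have aQ0 : 0 <= a / (a + 1) * Q^-1 by rewrite !mulr_ge0 ?invr_ge0//; lra.
have i2 : (a / (a + 1) * Q^-1) * (a / (a + 1) * Q^-1) <= ((k * e' + l) * (k * c' + l))^-1.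
  by rewrite invfM; apply: ler_pM => //; apply: D2; lra.
have d0 : 0 <= `|dl| by [].
apply: (@le_trans _ _ (`|dl| * (e' - c') * (a / (a + 1) / Q * (a / (a + 1) / Q)))); last first.
  by rewrite ler_wpM2l// mulr_ge0// subr_ge0.
have -> : `|dl| * (e' - c') * (a / (a + 1) / Q * (a / (a + 1) / Q)) =
   (e' - c') * (a / (a + 1)) ^+ 2 * (`|dl| * (Q^-1 * Q^-1)) by ring.
rewrite ler_wpM2l ?mulr_ge0 ?subr_ge0 ?exprn_ge0 ?divr_ge0//; try (rewrite ?invr_ge0; lra).
rewrite -mulrA.
apply: ler_wpM2l => //; rewrite -[leRHS]mul1r; apply: ler_pM i1; [lra| |lra].
by rewrite invfM mulr_ge0// D3//; lra.
Qed.
End Branches.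

(** * Holes of a forward invariant set *)

Section InvariantSet.
Context (R : realType) (N a : R) (d D : nat).
Hypothesis bnd : digit_bounds N a d D.
Variable A : set R.
Hypothesis A_push : forall i x, (d <= i <= D)%N -> a < x -> x < a + 1 ->
  N / (i.+1%:R + a) < x -> x < N / (i%:R + a) -> A x -> A (N / x - i%:R).

Let N0 : 0 < N. Proof. by have := db_N bnd; lra. Qed.
Let a0 : 0 < a. Proof. exact: db_a bnd. Qed.
Let ia i : 0 < i%:R + a. Proof. by have := ler0n R i; have := a0; lra. Qed.

Definition dense_on (c e : R) : Prop :=
  [/\ a <= c, c < e, e <= a + 1 &
      forall c' e', c <= c' -> c' < e' -> e' <= e -> exists2 x, c' < x < e' & A x].

Lemma image_in_range i (c e : R) : 0 < c -> c < e ->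
  N / (i.+1%:R + a) <= c -> e <= N / (i%:R + a) ->
  [/\ a <= N / e - i%:R, N / e - i%:R < N / c - i%:R & N / c - i%:R <= a + 1].
Proof.
move=> c0 ce pc ep; have e0 : 0 < e by lra.
split.
- by rewrite lerBrDl ler_pdivlMr// mulrC -ler_pdivlMr.
- by rewrite ltrD2r ltr_pM2l// ltf_pV2.
- rewrite lerBlDr ler_pdivrMr//.
  move: pc; rewrite ler_pdivrMr// -natr1; lra.
Qed.

Lemma dense_on_push i (c e : R) : (d <= i <= D)%N -> dense_on c e ->
  N / (i.+1%:R + a) <= c -> e <= N / (i%:R + a) ->
  dense_on (N / e - i%:R) (N / c - i%:R).
Proof.
move=> iD [ac ce ea H] pc ep.
have c0 : 0 < c := lt_le_trans a0 ac.
have e0 : 0 < e := lt_trans c0 ce.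
have [ia1 ia2 ia3] := image_in_range c0 ce pc ep.
split => // c' e' cc ce' ee.
have i0 := ler0n R i; have a0' := a0.
have [c'0 e'0] : 0 < c' + i%:R /\ 0 < e' + i%:R by split; lra.
have h1 : c <= N / (e' + i%:R).
  by rewrite ler_pdivlMr// mulrC -ler_pdivlMr// -lerBrDr.
have h2 : N / (c' + i%:R) <= e.
  by rewrite ler_pdivrMr// mulrC -ler_pdivrMr// -lerBlDr.
have h3 : N / (e' + i%:R) < N / (c' + i%:R).
  by rewrite ltr_pM2l// ltf_pV2 ?posrE// ltrD2r.
have [x /andP[x1 x2] Ax] := H _ _ h1 h3 h2.
have x0 : 0 < x by lra.
exists (N / x - i%:R); last by apply: A_push => //; lra.
rewrite ltrBrDr ltrBlDr ltr_pdivlMr// ltr_pdivrMr// ![_ * x]mulrC.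
by rewrite -ltr_pdivlMr// x2 -ltr_pdivrMr.
Qed.

Lemma dense_on_dom c e : dense_on c e -> [/\ a <= c, c < e & e <= a + 1].
Proof. by case. Qed.

Lemma dense_on_sub c e c' e' :
  dense_on c e -> c <= c' -> c' < e' -> e' <= e -> dense_on c' e'.
Proof.
move=> [ac ce ea H] cc ce' ee.
split=> //; [exact: le_trans cc|exact: le_trans ea|].
by move=> x y cx xy ye; apply: H => //; [exact: le_trans cx|exact: le_trans ee].
Qed.

(** Otherwise [growth_step] would lengthen dense intervals by at least
    [(e - c) / 20] for ever, whereas they have length at most 1. *)
Lemma dense_on_grows c e : dense_on c e -> dense_on a (a + 1).
Proof.
move=> dce; apply: contrapT => nd.
have ce : 0 < e - c by case: dce => _ + _ _; rewrite subr_gt0.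
have grow n : exists c' e', dense_on c' e' /\ (1 + n%:R / 20) * (e - c) <= e' - c'.
  elim: n => [|n [c' [e' [dce' h]]]].
    by exists c, e; split => //; rewrite mul0r addr0 mul1r.
  have [//|] := growth_step bnd dense_on_dom dense_on_sub dense_on_push dce'.
  move=> [c2 [e2 [d2 h2]]]; exists c2, e2; split => //.
  apply: le_trans h2; rewrite -natr1.
  have : 0 <= n%:R / 20 * (e - c) by rewrite mulr_ge0 ?divr_ge0// ltW.
  lra.
pose n := (Num.truncn (20 / (e - c))).+1.
have [c' [e' [[h1 h2 h3 _] h4]]] := grow n.
have : 20 / (e - c) < n%:R by rewrite /n; exact: truncnS_gt.
rewrite ltr_pdivrMr// => h5.
have : 1 * (e - c) + (n%:R * (e - c)) / 20 <= 1 by move: h4; lra.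
lra.
Qed.

Hypothesis A_hole : ~ dense_on a (a + 1).

Lemma hole c e : a <= c -> c < e -> e <= a + 1 ->
  exists c' e', [/\ c <= c', c' < e', e' <= e & forall x, c' < x < e' -> ~ A x].
Proof.
move=> ac ce ea; apply: contrapT => nh; apply: A_hole; apply: (@dense_on_grows c e).
split => // c' e' h1 h2 h3; apply: contrapT => nA; apply: nh; exists c', e'; split => //.
by move=> x xce Ax; apply: nA; exists x.
Qed.

(** Cut the interval into cells of length [dl / 2]: every interval of length [dl]
    contains one of these finitely many cells, and each cell has a hole. *)
Lemma uniform_hole (dl : R) : 0 < dl -> exists2 eta, 0 < eta &
  forall c e, a <= c -> e <= a + 1 -> dl <= e - c ->
  exists c' e', [/\ c <= c', c' < e', e' <= e & eta <= e' - c'] /\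
    forall x, c' < x < e' -> ~ A x.
Proof.
move=> dl0; pose h := dl / 2.
have h0 : 0 < h by rewrite divr_gt0.
have cells k : exists2 eta, 0 < eta & forall j, (j < k)%N -> a + j.+1%:R * h <= a + 1 ->
    exists c' e', [/\ a + j%:R * h <= c', c' < e', e' <= a + j.+1%:R * h & eta <= e' - c'] /\
      forall x, c' < x < e' -> ~ A x.
  elim: k => [|k [eta eta0 IH]]; first by exists 1.
  have [ka|ka] := lerP (a + k.+1%:R * h) (a + 1); last first.
    exists eta => // j; rewrite ltnS leq_eqVlt => /orP[/eqP->|]; last exact: IH.
    by rewrite leNgt ka.
  have [||c1 [e1 [h1 h2 h3 h4]]] := @hole (a + k%:R * h) (a + k.+1%:R * h) _ _ ka.
  - by rewrite lerDl mulr_ge0// ltW.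
  - by rewrite ltrD2l ltr_pM2r// ltr_nat.
  exists (Num.min eta (e1 - c1)); first by rewrite lt_min eta0 subr_gt0.
  move=> j; rewrite ltnS leq_eqVlt => /orP[/eqP-> _|jk ja].
    by exists c1, e1; split => //; split => //; rewrite ge_min lexx orbT.
  have [c2 [e2 [[g1 g2 g3 g4] g5]]] := IH j jk ja.
  by exists c2, e2; split => //; split => //; rewrite ge_min g4.
have [eta eta0 H] := cells (Num.truncn (h^-1)).+2.
exists eta => // c e ac ea de.
have ce : c < e by lra.
have x0 : 0 <= (c - a) / h by rewrite divr_ge0 ?subr_ge0// ltW.
have := truncn_itv x0; set j := Num.truncn _ => /andP[j1 j2].
move: j1 j2; rewrite ler_pdivlMr// ltr_pdivrMr// => j1 j2.
have dh : dl = h + h by rewrite /h; field.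
have jE : j.+2%:R * h = j%:R * h + h + h by rewrite -!natr1; ring.
have [|| c1 [e1 [[h1 h2 h3 h4] h5]]] := H j.+1.
- rewrite !ltnS -(ler_nat R); apply: (@le_trans _ _ (j%:R : R)) => //.
  rewrite ler_nat; apply: le_truncn.
  by rewrite ler_pdivrMr// mulVf ?gt_eqF//; lra.
- rewrite jE; lra.
exists c1, e1; split => //; split => //; first by lra.
by apply: le_trans h3 _; rewrite jE; lra.
Qed.

(** * Pulling intervals forward through iterates of the map *)

(** The model is an inverse branch [M] of an iterate of the map, defined between
    [c] and [e].  That the iterate undoes [M] is retained only through its
    consequence for the forward invariant set [A]. *)
Definition inverse_branch (M : R -> R) (c e L : R) : Prop :=
  [/\ [/\ a <= c, c < e & e <= a + 1], nonneg_mobius M,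
      forall z z', c <= z -> z <= z' -> z' <= e -> `|M z' - M z| <= L * (z' - z)
    & forall z, c < z < e -> A (M z) -> A z].

(** [M'] on its interval parametrizes the same image as [M]; only the inclusion
    and the length of the image matter. *)
Definition extends_to (M : R -> R) (c e : R) (M' : R -> R) (c' e' : R) : Prop :=
  `|M' e' - M' c'| = `|M e - M c| /\ M @` `]c, e[ `<=` M' @` `]c', e'[.

Lemma inverse_branch_sub M (c e L c' e' : R) : inverse_branch M c e L ->
  c <= c' -> c' < e' -> e' <= e -> inverse_branch M c' e' L.
Proof.
move=> [[ac ce ea] mM lM AM] cc ce' ee; split => //.
- by split => //; [exact: le_trans cc|exact: le_trans ea].
- by move=> z z' h1 h2 h3; apply: lM => //; [exact: le_trans h1|exact: le_trans ee].
- move=> z /andP[h1 h2]; apply: AM.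
  by rewrite (le_lt_trans cc)//= (lt_le_trans h2).
Qed.

(** Precomposing [M] with the inverse of the branch of digit [i] contracts by
    [20 / 21], by [min_slope]. *)
Lemma inverse_branch_push i M (c e L : R) : (d <= i <= D)%N ->
  inverse_branch M c e L -> N / (i.+1%:R + a) <= c -> e <= N / (i%:R + a) ->
  exists M' : R -> R,
  inverse_branch M' (N / e - i%:R) (N / c - i%:R) (20 / 21 * L) /\
  extends_to M c e M' (N / e - i%:R) (N / c - i%:R).
Proof.
move=> iD [[ac ce ea] mM lM AM] pc ep; exists (fun z => M (N / (i%:R + z))).
have c0 : 0 < c := lt_le_trans a0 ac.
have e0 : 0 < e := lt_trans c0 ce.
have [ia1 ia2 ia3] := image_in_range c0 ce pc ep.
have NK z : 0 < z -> N / (N / z) = z by move=> z0; field; rewrite !gt_eqF.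
have L0 : 0 <= L.
  have := lM c e (lexx _) (ltW ce) (lexx _).
  by move=> /(le_trans (normr_ge0 _)); rewrite pmulr_lge0// subr_gt0.
have range z : N / e - i%:R <= z <= N / c - i%:R ->
    [/\ 0 < i%:R + z, c <= N / (i%:R + z) & N / (i%:R + z) <= e].
  move=> /andP[h1 h2].
  have iz : 0 < i%:R + z by apply: lt_le_trans (_ : N / e <= _); rewrite ?divr_gt0// -lerBlDl.
  split => //; first by rewrite ler_pdivlMr// mulrC -ler_pdivlMr// -lerBrDl.
  by rewrite ler_pdivrMr// mulrC -ler_pdivrMr// -lerBlDl.
split; split.
- by split.
- exact: nonneg_mobius_inv.
- move=> z z' h1 h2 h3.
  have [iz cz ze] : [/\ 0 < i%:R + z, c <= N / (i%:R + z) & N / (i%:R + z) <= e].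
    by apply: range; rewrite h1 (le_trans h2).
  have [iz' cz' ze'] : [/\ 0 < i%:R + z', c <= N / (i%:R + z') & N / (i%:R + z') <= e].
    by apply: range; rewrite h3 andbT (le_trans h1).
  have zz : N / (i%:R + z') <= N / (i%:R + z).
    by rewrite ler_pM2l// lef_pV2 ?posrE// lerD2l.
  rewrite distrC; apply: le_trans (lM _ _ cz' zz ze) _.
  have -> : 20 / 21 * L * (z' - z) = L * ((z' - z) * (20 / 21)) by ring.
  rewrite ler_wpM2l//.
  set x := N / (i%:R + z) in zz cz ze *; set x' := N / (i%:R + z') in zz cz' ze' *.
  have x0 : 0 < x by apply: lt_le_trans cz.
  have x'0 : 0 < x' by apply: lt_le_trans cz'.
  have -> : x - x' = (z' - z) * (x * x' / N).
    by rewrite /x /x'; field; rewrite !gt_eqF.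
  rewrite ler_wpM2l ?subr_ge0// ler_pdivrMr//.
  have := min_slope bnd.
  have : x * x' <= (a + 1) * (a + 1).
    by apply: ler_pM; rewrite ?(ltW x0) ?(ltW x'0)//; exact: le_trans ea.
  rewrite expr2; lra.
- move=> z /andP[z1 z2].
  have [iz cz ze] : [/\ 0 < i%:R + z, c <= N / (i%:R + z) & N / (i%:R + z) <= e].
    by apply: range; rewrite !ltW.
  have {}cz : c < N / (i%:R + z).
    by rewrite ltr_pdivlMr// mulrC -ltr_pdivlMr// -ltrBrDl.
  have {}ze : N / (i%:R + z) < e.
    by rewrite ltr_pdivrMr// mulrC -ltr_pdivrMr// -ltrBlDl.
  move=> AMz; have Az : A (N / (i%:R + z)) by apply: AM AMz; rewrite cz ze.
  have := A_push iD (le_lt_trans ac cz) (lt_le_trans ze ea) (le_lt_trans pc cz) (lt_le_trans ze ep) Az.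
  by rewrite NK// addrAC subrr add0r.
- by rewrite ![i%:R + _]addrC !subrK !NK// distrC.
- move=> _ [x /= xce <-]; exists (N / x - i%:R).
    move: xce; rewrite !in_itv/= => /andP[x1 x2].
    have x0 : 0 < x := lt_trans c0 x1.
    by rewrite !ltrD2r !ltr_pM2l// !ltf_pV2// x1 x2.
  move: xce; rewrite in_itv/= => /andP[x1 x2].
  by rewrite addrC subrK NK// (lt_trans c0).
Qed.

Definition avoids (s : seq R) (c e : R) := forall x, x \in s -> ~~ (c < x < e).

(** The finite set [s] contains the discontinuities of the [K]-th iterate: the
    boundaries of the cylinders, and the preimages of the discontinuities of
    the previous iterate. *)
Lemma inverse_branch_iter K : exists s : seq R, forall M c e L,
  inverse_branch M c e L -> avoids s c e ->
  exists M' c' e', inverse_branch M' c' e' ((20 / 21) ^+ K * L) /\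
    extends_to M c e M' c' e'.
Proof.
elim: K => [|K [s IH]].
  by exists [::] => M c e L h _; exists M, c, e; rewrite expr0 mul1r; split => //; split.
exists ([seq N / (i%:R + a) | i <- iota 0 D.+1] ++
        [seq N / (i%:R + y) | i <- iota 0 D.+1, y <- s]) => M c e L h av.
have [[ac ce ea] _ _ _] := h.
have c0 : 0 < c := lt_le_trans a0 ac.
have e0 : 0 < e := lt_trans c0 ce.
have [i [/andP[di iD] pc cp]] := locate_digit bnd ac (lt_le_trans ce ea).
have iD1 : i \in iota 0 D.+1 by rewrite mem_iota.
have ep : e <= N / (i%:R + a).
  rewrite leNgt; apply/negP => pe.
  have /av : N / (i%:R + a) \in [seq N / (i%:R + a) | i <- iota 0 D.+1] ++
        [seq N / (i%:R + y) | i <- iota 0 D.+1, y <- s].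
    by rewrite mem_cat; apply/orP; left; apply/mapP; exists i.
  by rewrite cp pe.
have dD : (d <= i <= D)%N by rewrite di.
have [M1 [h1 [len1 sub1]]] := inverse_branch_push dD h pc ep.
have [|M2 [c2 [e2 [h2 [len2 sub2]]]]] := IH _ _ _ _ h1.
  move=> y ys; apply/negP => /andP[y1 y2].
  have iy : 0 < i%:R + y by apply: lt_trans (_ : N / e < _); rewrite ?divr_gt0// -ltrBlDl.
  have /av : N / (i%:R + y) \in [seq N / (i%:R + a) | i <- iota 0 D.+1] ++
        [seq N / (i%:R + y) | i <- iota 0 D.+1, y <- s].
    by rewrite mem_cat orbC; apply/orP; left; apply/allpairsP; exists (i, y).
  rewrite ltr_pdivlMr// mulrC -ltr_pdivlMr// -ltrBrDl y2/=.
  by rewrite ltr_pdivrMr// mulrC -ltr_pdivrMr// -ltrBlDl y1.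
exists M2, c2, e2; split; last first.
  by split; [rewrite len2|exact: subset_trans sub2].
by rewrite exprSr -mulrA.
Qed.

Lemma separation (s : seq R) : exists2 dl, 0 < dl &
  {in s &, forall x y, x != y -> dl <= `|x - y|}.
Proof.
elim: s => [|x s [dl dl0 IH]]; first by exists 1.
have [dx dx0 Hx] : exists2 dx, 0 < dx & forall y, y \in s -> x != y -> dx <= `|x - y|.
  elim: s {IH} => [|y s [dx dx0 H]]; first by exists 1.
  have [xy|xy] := eqVneq x y.
    exists dx => // z; rewrite in_cons => /orP[/eqP->|]; first by rewrite xy eqxx.
    exact: H.
  exists (Num.min dx `|x - y|); first by rewrite lt_min dx0 normr_gt0 subr_eq0.
  move=> z; rewrite in_cons => /orP[/eqP-> _|zs xz]; first by rewrite ge_min lexx orbT.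
  by rewrite ge_min H.
exists (Num.min dl dx); first by rewrite lt_min dl0.
move=> y z; rewrite !in_cons => /orP[/eqP->|ys] /orP[/eqP->|zs] yz.
- by rewrite eqxx in yz.
- by rewrite ge_min Hx ?orbT.
- by rewrite ge_min distrC Hx ?orbT// eq_sym.
- by rewrite ge_min IH.
Qed.

(** * A forward invariant set with holes is null *)

(** The Lebesgue outer measure, subadditive on arbitrary sets. *)
Local Notation mu := ((@wlength R idfun)^*)%mu.

Lemma outer_measure_itv (x y : R) : x <= y -> mu `[x, y]%classic = (y - x)%:E.
Proof.
move=> xy; rewrite -[LHS]/(lebesgue_measure `[x, y]%classic) lebesgue_measure_itv /= lte_fin.
case: ltP => // yx; congr EFin; lra.
Qed.

Lemma outer_measure_mobius_image M (c e : R) : nonneg_mobius M -> 0 < c -> c <= e ->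
  (mu (M @` `[c, e]%classic) <= `|M e - M c|%:E)%E.
Proof.
move=> mM c0 ce; wlog : / exists x y, x <= y /\ y - x = `|M e - M c| /\
    forall z, c <= z <= e -> x <= M z <= y.
  apply; have key z : c <= z <= e -> `|M e - M c| = `|M e - M z| + `|M z - M c|.
    by move=> /andP[cz ze]; apply: nonneg_mobius_between.
  have [h|h] := lerP (M c) (M e).
    have nE : `|M e - M c| = M e - M c by rewrite ger0_norm// subr_ge0.
    exists (M c), (M e); split => //; split => //.
    move=> z /key; rewrite nE => hz.
    have := ler_norm (M e - M z); have := ler_norm (M z - M c).
    have := normr_ge0 (M e - M z); have := normr_ge0 (M z - M c); lra.
  have nE : `|M e - M c| = M c - M e by rewrite distrC ger0_norm// subr_ge0 ltW.
  exists (M e), (M c); split; [exact: ltW|split => // z /key].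
  rewrite nE => hz.
  have := ler_norm (- (M e - M z)); have := ler_norm (- (M z - M c)); rewrite !normrN.
  have := normr_ge0 (M e - M z); have := normr_ge0 (M z - M c); lra.
move=> [x [y [xy [<- H]]]]; rewrite -outer_measure_itv//.
apply: le_outer_measure => _ [z /= zce <-]; rewrite in_itv/=; apply: H.
by move: zce; rewrite in_itv.
Qed.

Lemma iterate_contraction : (20 / 21 : R) ^+ 30 <= 1 / 4.
Proof.
have h : (20 / 21 : R) ^+ 5 <= 79 / 100 by lra.
have h2 : (20 / 21 : R) ^+ 10 <= (79 / 100) ^+ 2.
  by rewrite (exprM _ 5 2) lerXn2r ?nnegrE//; lra.
have h3 : (20 / 21 : R) ^+ 30 <= ((79 / 100) ^+ 2) ^+ 3.
  by rewrite (exprM _ 10 3) lerXn2r ?nnegrE//; lra.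
apply: le_trans h3 _; lra.
Qed.

(** The error term is the trivial bound for [n = 0].  At each step a long
    interval is settled by its hole, without error; a short one contains at
    most one discontinuity of the 30th iterate, and becomes at most two
    intervals whose Lipschitz constants are four times smaller, which halves
    the total error. *)
Lemma inverse_branch_sparse : exists2 g : R, 0 < g &
  forall n M c e L, inverse_branch M c e L ->
    (mu ((M @` `]c, e[) `&` A) <= ((1 - g) * `|M e - M c| + 2^-1 ^+ n * L)%:E)%E.
Proof.
have [s Hs] := inverse_branch_iter 30.
have [dl dl0 sep] := separation s.
have [eta eta0 Heta] := uniform_hole dl0.
pose g := Num.min 1 (eta * (a / (a + 1)) ^+ 2).
have a1 : 0 < a + 1 by have := a0; lra.
have g0 : 0 < g by rewrite lt_min ltr01 mulr_gt0 ?exprn_gt0 ?divr_gt0.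
have g1 : g <= 1 by rewrite ge_min lexx.
exists g => // n; elim: n => [|n IH] M c e L h.
  have [[ac ce ea] mM lM _] := h; have c0 : 0 < c := lt_le_trans a0 ac.
  apply: le_trans (le_outer_measure _ _ _ (@subIsetl _ _ _)) _.
  apply: (@le_trans _ _ (mu (M @` `[c, e]%classic))).
    by apply: le_outer_measure; apply: image_subset; exact: subset_itv_oo_cc.
  apply: le_trans (outer_measure_mobius_image mM c0 (ltW ce)) _.
  rewrite lee_fin expr0 mul1r.
  have := lM c e (lexx _) (ltW ce) (lexx _); set X := `|_| => hX.
  have X0 : 0 <= X by exact: normr_ge0.
  have L0 : 0 <= L by move: (le_trans X0 hX); rewrite pmulr_lge0// subr_gt0.
  have : L * (e - c) <= L * 1 by rewrite ler_wpM2l//; lra.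
  have : 0 <= (1 - g) * X by rewrite mulr_ge0// subr_ge0.
  lra.
have [[ac ce ea] mM lM AM] := h; have c0 : 0 < c := lt_le_trans a0 ac.
have L0 : 0 <= L.
  have := lM c e (lexx _) (ltW ce) (lexx _).
  by move=> /(le_trans (normr_ge0 _)); rewrite pmulr_lge0// subr_gt0.
have half0 : 0 <= (2^-1 : R) ^+ n by rewrite exprn_ge0.
have halfL : 0 <= (2^-1 : R) ^+ n * L by rewrite mulr_ge0.
have halfS : (2^-1 : R) ^+ n.+1 * L = (2^-1 ^+ n * L) / 2 by rewrite exprS; ring.
have [short|long] := ltP (e - c) dl; last first.
  have [c' [e' [[cc ce' ee he] hA]]] := Heta c e ac ea long.
  have c'0 : 0 < c' := lt_le_trans c0 cc.
  have e'0 : 0 < e' := lt_trans c'0 ce'.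
  apply: (@le_trans _ _ (mu (M @` `[c, c']%classic `|` M @` `[e', e]%classic))).
    apply: le_outer_measure => _ [[z /= zce <-] Az].
    move: zce; rewrite in_itv/= => /andP[cz ze].
    have {}Az : A z by apply: AM Az; rewrite cz ze.
    have [zc|cz'] := lerP z c'; first by left; exists z => //=; rewrite in_itv/= zc ltW.
    have [ez|ze'] := lerP e' z; first by right; exists z => //=; rewrite in_itv/= ez ltW.
    by exfalso; apply: (hA z) => //; rewrite cz' ze'.
  apply: le_trans (outer_measureU2 _ _ _) _.
  apply: le_trans (leeD (outer_measure_mobius_image mM c0 cc) (outer_measure_mobius_image mM e'0 ee)) _.
  rewrite -EFinD lee_fin.
  have := nonneg_mobius_between mM c0 (le_trans cc (ltW ce')) ee.
  have := nonneg_mobius_between mM c0 cc (ltW ce').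
  have := nonneg_mobius_distortion a0 mM ac cc (ltW ce') ee ea.
  set X := `|M e - M c| => dist -> XE.
  have : g * X <= `|M e' - M c'|.
    apply: le_trans dist; rewrite ler_wpM2r /X//.
    by rewrite /g ge_min; apply/orP; right; rewrite ler_wpM2r// exprn_ge0// divr_ge0// ltW.
  by rewrite halfS XE; lra.
have branch_avoiding c1 e1 : inverse_branch M c1 e1 L -> avoids s c1 e1 ->
    (mu ((M @` `]c1, e1[) `&` A) <=
      ((1 - g) * `|M e1 - M c1| + 2^-1 ^+ n * L / 4)%:E)%E.
  move=> h1 av; have [M' [c' [e' [h' [len sub]]]]] := Hs _ _ _ _ h1 av.
  apply: (@le_trans _ _ (mu ((M' @` `]c', e'[) `&` A))).
    by apply: le_outer_measure; exact: setSI.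
  apply: le_trans (IH _ _ _ _ h') _; rewrite lee_fin len lerD2l.
  rewrite [leLHS]mulrCA mulrC ler_wpM2l//.
  by have := iterate_contraction; lra.
have [[m ms cme]|none] := pselect (exists2 m, m \in s & c < m < e); last first.
  apply: le_trans (branch_avoiding c e h _) _.
    by move=> x xs; apply/negP => xce; apply: none; exists x.
  by rewrite lee_fin halfS; lra.
move/andP: cme => [cm me].
have hl : inverse_branch M c m L by apply: inverse_branch_sub h _ _ _ => //; exact: ltW.
have hr : inverse_branch M m e L by apply: inverse_branch_sub h _ _ _ => //; exact: ltW.
(* two points of [s] in this interval would be closer than [dl] *)
have only x : x \in s -> c < x < e -> x = m.
  move=> xs /andP[cx xe]; apply/eqP; rewrite -[_ == _]negbK; apply/negP => xm.
  have := sep x m xs ms xm; rewrite leNgt => /negP; apply.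
  by rewrite ltr_norml; lra.
have avl : avoids s c m.
  move=> x xs; apply/negP => /andP[cx xm]; have := only x xs; rewrite cx (lt_trans xm)// => /(_ isT) xE.
  by rewrite xE ltxx in xm.
have avr : avoids s m e.
  move=> x xs; apply/negP => /andP[mx xe]; have := only x xs; rewrite (lt_trans cm)// xe => /(_ isT) xE.
  by rewrite xE ltxx in mx.
apply: (@le_trans _ _ (mu (((M @` `]c, m[) `&` A) `|` ((M @` `]m, e[) `&` A) `|` M @` `[m, m]%classic))).
  apply: le_outer_measure => _ [[z /= zce <-] Az].
  move: zce; rewrite in_itv/= => /andP[cz ze].
  have [zm|mz|zm] := ltgtP z m.
  - by left; left; split => //; exists z => //=; rewrite in_itv/= cz.
  - by left; right; split => //; exists z => //=; rewrite in_itv/= mz.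
  - by right; exists z => //=; rewrite in_itv/= zm lexx.
have m0 : 0 < m := lt_trans c0 cm.
apply: le_trans (outer_measureU2 _ _ _) _.
apply: le_trans (leeD (outer_measureU2 _ _ _) (outer_measure_mobius_image mM m0 (lexx m))) _.
rewrite subrr normr0 adde0.
apply: le_trans (leeD (branch_avoiding _ _ hl avl) (branch_avoiding _ _ hr avr)) _.
rewrite -EFinD lee_fin halfS (nonneg_mobius_between mM c0 (ltW cm) (ltW me)); lra.
Qed.

(** The sparsity of [A] in each interval of a cover gives
    [mu A <= (1 - g) (mu A + eps)] for all positive [eps]. *)
Lemma outer_measure_eq0 : mu (A `&` `]a, (a + 1)[%classic) = 0%E.
Proof.
set A' := A `&` _.
have [g g0 Hg] := inverse_branch_sparse.
have itv_sparse c e : a <= c -> c < e -> e <= a + 1 ->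
    (mu (`]c, e[ `&` A) <= ((1 - g) * (e - c))%:E)%E.
  move=> ac ce ea.
  have hid : inverse_branch id c e 1.
    split=> //; first exact: nonneg_mobius_id.
    by move=> z z' _ zz _; rewrite mul1r ger0_norm// subr_ge0.
  apply/lee_addgt0Pr => eps eps0.
  have /cvgrPdist_lt/(_ _ eps0) : (fun n => (2^-1 : R) ^+ n) @ \oo --> (0 : R).
    by apply: cvg_expr; rewrite ger0_norm//; lra.
  move=> [n _ /(_ n (leqnn n))]; rewrite /= sub0r normrN ger0_norm ?exprn_ge0// => hn.
  have := Hg n _ _ _ _ hid; rewrite image_id mulr1 (ger0_norm (_ : 0 <= e - c)) ?subr_ge0 ?(ltW ce)//.
  move=> /le_trans; apply; rewrite -EFinD lee_fin; lra.
have g1 : g <= 1.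
  have h := itv_sparse a (a + 1) (lexx _) _ (lexx _).
  have : (0%:E <= ((1 - g) * (a + 1 - a))%:E)%E.
    by apply: le_trans (h _); [exact: outer_measure_ge0|lra].
  by rewrite lee_fin; lra.
have fin : (mu A' < +oo)%E.
  apply: (@le_lt_trans _ _ (mu `[a, a + 1]%classic)).
    apply: le_outer_measure; apply: subset_trans (@subIsetr _ _ _) _.
    exact: subset_itv_oo_cc.
  by rewrite outer_measure_itv ?ltry//; lra.
have finm : mu A' \is a fin_num by rewrite ge0_fin_numE ?outer_measure_ge0.
have bound eps : 0 < eps -> (mu A' <= (1 - g)%:E * (mu A' + eps%:E))%E.
  move=> eps0.
  have [F [Fitv AF] Fe] : exists2 F, open_itv_cover A' F &
      (\sum_(0 <= k <oo) wlength idfun (F k) <= mu A' + eps%:E)%E.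
    move: (finm); rewrite outer_measure_open_itv_cover.
    move=> /lb_ereal_inf_adherent-/(_ _ eps0)[_/= [F]] AF <- Fe.
    by exists F => //; exact/ltW.
  apply: (@le_trans _ _ (mu (\bigcup_k (F k `&` A')))).
    by apply: le_outer_measure => x A'x; have [k _ Fkx] := AF _ A'x; exists k.
  apply: le_trans (outer_measure_sigma_subadditive mu _) _.
  apply: (@le_trans _ _ ((1 - g)%:E * \sum_(0 <= k <oo) wlength idfun (F k))%E); last first.
    by rewrite lee_wpmul2l// lee_fin subr_ge0.
  rewrite -nneseriesZl; last by move=> k _; exact: wlength_ge0.
  apply: lee_nneseries => [k _ _|k _]; first exact: outer_measure_ge0.
  have [[x y] ->] := Fitv k.
  rewrite wlength_itv/= lte_fin.
  have [xy|yx] := ltP x y; last first.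
    by rewrite mule0 set_itv_ge ?set0I ?outer_measure0// bnd_simp -leNgt.
  have [ce|ec] := ltP (Num.max x a) (Num.min y (a + 1)); last first.
    rewrite (_ : _ `&` _ = set0) ?outer_measure0.
      by rewrite -EFinB -EFinM lee_fin mulr_ge0// subr_ge0// ltW.
    rewrite -subset0 => z [/=]; rewrite in_itv/= => /andP[xz zy] [_].
    rewrite /= in_itv/= => /andP[az za].
    have : Num.max x a < Num.min y (a + 1).
      by rewrite gt_max !lt_min (lt_trans xz)//= (lt_trans xz)// (lt_trans az)// (lt_trans az).
    by rewrite ltNge ec.
  apply: (@le_trans _ _ (mu (`](Num.max x a), (Num.min y (a + 1))[ `&` A))).
    apply: le_outer_measure => z [/=]; rewrite in_itv/= => /andP[xz zy] [Az].
    rewrite /= in_itv/= => /andP[az za]; split => //=.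
    by rewrite in_itv/= gt_max lt_min xz az zy za.
  apply: le_trans (itv_sparse _ _ _ ce _) _; rewrite ?le_max ?lexx ?orbT//.
    by rewrite ge_min lexx orbT.
  rewrite -EFinB -EFinM lee_fin ler_wpM2l ?subr_ge0//.
  by rewrite lerB// ?ge_min ?le_max lexx.
have [r rE] : exists r, mu A' = r%:E by exists (fine (mu A')); rewrite fineK.
rewrite rE in bound *.
have r0 : 0 <= r by rewrite -lee_fin -rE outer_measure_ge0.
congr EFin; apply/eqP; rewrite eq_le r0 andbT leNgt; apply/negP => rp.
have := bound (g * r / 2) _; rewrite !divr_gt0 ?mulr_gt0// => /(_ isT).
rewrite -EFinD -EFinM lee_fin leNgt => /negP; apply.
have gr : 0 < g * r by rewrite mulr_gt0.
have : 0 <= g * (g * r) by rewrite mulr_ge0// ltW.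
lra.
Qed.
End InvariantSet.

(** * The N-expansion map *)

Section NExpansionDynamics.
Context (R : realType) (N : nat) (a : R).
Implicit Types (x : R) (i : int).

Lemma Tmap_branch (i : nat) x : 0 < a -> a < x ->
  N%:R / (i.+1%:R + a) < x -> x < N%:R / (i%:R + a) ->
  Tmap N a x = N%:R / x - i%:R.
Proof.
move=> a0 ax px xp; have x0 : 0 < x := lt_trans a0 ax.
have ia (j : nat) : 0 < j%:R + a by have := ler0n R j; lra.
rewrite /Tmap /digit gt_eqF//= (_ : Num.floor _ = i)//.
apply: floor_def; rewrite -[i%:~R]/(i%:R : R) -[(i%:Z + 1)%:~R]/((i + 1)%:R : R) addn1.
rewrite lerBrDr ler_pdivlMr// ltrBlDr ltr_pdivrMr// ![_ * x]mulrC.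
by rewrite -ler_pdivlMr// ltW//= -ltr_pdivrMr.
Qed.

Definition avoiding (b1 b2 : R) (n : nat) : set R :=
  [set x | forall k, (n <= k)%N -> ~ `]b1, b2[%classic (iter k (Tmap N a) x)].

Variables (d D : nat).
Hypothesis bnd : digit_bounds (N%:R : R) a d D.

Let a0 : 0 < a. Proof. exact: db_a bnd. Qed.
Let ia (i : nat) : 0 < i%:R + a. Proof. by have := ler0n R i; have := a0; lra. Qed.

Lemma avoiding_push b1 b2 n (i : nat) x : (d <= i <= D)%N -> a < x -> x < a + 1 ->
  N%:R / (i.+1%:R + a) < x -> x < N%:R / (i%:R + a) ->
  avoiding b1 b2 n x -> avoiding b1 b2 n (N%:R / x - i%:R).
Proof.
move=> _ ax _ px xp Ax k nk; rewrite -(Tmap_branch a0 ax px xp) -iterSr.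
by apply: Ax; exact: leqW.
Qed.

(** The branch of digit [d + 1] is onto, so an interval can be pulled back through
    it as often as wanted. *)
Lemma preimage_itv b1 b2 n : b1 < b2 -> `]b1, b2[%classic `<=` Ialpha a ->
  exists c e, [/\ a <= c, c < e, e <= a + 1 &
    forall x, c < x < e -> `]b1, b2[%classic (iter n (Tmap N a) x)].
Proof.
move=> b12 bI; elim: n => [|n [c [e [ac ce ea H]]]].
  (* the middle third lies in the domain together with its endpoints *)
  have := bI ((2 * b1 + b2) / 3); have := bI ((b1 + 2 * b2) / 3).
  rewrite /Ialpha/= !in_itv/=.
  move=> /(_ ltac:(lra)) h1 /(_ ltac:(lra)) h2.
  exists ((2 * b1 + b2) / 3), ((b1 + 2 * b2) / 3); split; [lra..|].
  move=> x; rewrite in_itv/= => ?; lra.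
case: (bnd) => _ N2 d1 dD dl du Dl Du.
have N0 : 0 < N%:R :> R by lra.
pose i : R := d.+1%:R.
have Ei : i = d%:R + 1 by rewrite /i natr1.
have dR := ler0n R d.
have c0 : 0 < c + i by have := a0; lra.
have e0 : 0 < e + i by lra.
have dD' : d%:R + 4 <= D%:R :> R by rewrite -natrD ler_nat.
have top x : c < x -> N%:R / (x + i) < N%:R / (i + a).
  by move=> cx; rewrite ltr_pM2l// ltf_pV2 ?posrE; lra.
exists (N%:R / (e + i)), (N%:R / (c + i)); split.
- rewrite ler_pdivlMr//; apply: le_trans (ltW Dl); rewrite mulrC ler_wpM2r ?ltW//; lra.
- by rewrite ltr_pM2l// ltf_pV2 ?posrE ?ltrD2r.
- rewrite ler_pdivrMr//; apply: le_trans (ltW du) _; rewrite mulrC ler_wpM2l//; lra.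
move=> x /andP[ex xc].
have x0 : 0 < x by apply: lt_trans ex; rewrite divr_gt0.
have h1 : N%:R / x < e + i by rewrite ltr_pdivrMr// mulrC -ltr_pdivrMr.
have h2 : c + i < N%:R / x by rewrite ltr_pdivlMr// mulrC -ltr_pdivlMr.
rewrite iterSr (@Tmap_branch d.+1 x a0).
- by apply: H; rewrite ltrBrDr h2 ltrBlDr h1.
- apply: le_lt_trans ex; rewrite ler_pdivlMr//; apply: le_trans (ltW Dl).
  by rewrite mulrC ler_wpM2r ?ltW//; lra.
- apply: le_lt_trans ex; rewrite ler_pM2l// lef_pV2 ?posrE// -natr1 -/i; lra.
- by apply: lt_le_trans xc _; rewrite ler_pM2l// lef_pV2 ?posrE// -/i; lra.
Qed.

Lemma avoiding_hole b1 b2 n : b1 < b2 -> `]b1, b2[%classic `<=` Ialpha a ->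
  ~ dense_on a (avoiding b1 b2 n) a (a + 1).
Proof.
move=> b12 bI [_ _ _ dns]; have [c [e [ac ce ea H]]] := preimage_itv n b12 bI.
by have [x xce /(_ n (leqnn n))] := dns c e ac ce ea; apply; exact: H.
Qed.

Lemma not_eventually_avoided b1 b2 : b1 < b2 -> `]b1, b2[%classic `<=` Ialpha a ->
  ~ eventually_avoided N a b1 b2.
Proof.
move=> b12 bI ev.
have : (@lebesgue_measure R).-negligible `]a, (a + 1)[%classic.
  apply: negligibleS (negligibleU ev (@negligible_bigcup _ _ _ (@lebesgue_measure R)
    (fun n => avoiding b1 b2 n `&` `]a, (a + 1)[%classic) _)).
    move=> x xI; rewrite /setU/=; apply: contrapT => /not_orP[/contrapT evx nx].
    have /evx [n0 Hn] : Ialpha a x by apply: subset_itv_oo_cc xI.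
    by apply: nx; exists n0.
  move=> n; apply/negligible_outer_measure.
  apply: (outer_measure_eq0 bnd); [exact: avoiding_push|exact: avoiding_hole].
move=> [Z [mZ Z0 IZ]]; pose I : set R := `]a, (a + 1)[%classic.
have : (lebesgue_measure I <= lebesgue_measure Z)%E.
  by apply: le_measure IZ; rewrite inE//=; exact: measurable_itv.
rewrite Z0 lebesgue_measure_itv/= lte_fin ltrDl ltr01 -EFinB lee_fin; lra.
Qed.
End NExpansionDynamics.

Lemma cylinder_digit_le (R : realType) (N : nat) (a : R) (d D : nat) (i : int) :
  0 < a -> 0 < N%:R :> R -> (d <= D)%N -> (d%:R + a) * (a + 1) <= N%:R ->
  (D%:R + a) * a < N%:R -> N%:R <= (D%:R + 1 + a) * a ->
  cylinder N a i !=set0 -> (d%:Z <= i <= D%:Z)%R.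
Proof.
move=> a0 N0 dD dl Dl Du [x [xI xi]].
move: xI xi; rewrite /Ialpha /digit/= in_itv/= => /andP[ax xa].
have x00 : 0 < x by lra.
case: ifP => [/andP[_ xint] <-|nint /esym xi].
  move: xint; rewrite intrEfloor => /eqP; set m := Num.floor _ => Em.
  have {Em} Em : N%:R = (m%:~R + a) * a by rewrite Em; field; rewrite gt_eqF.
  have : (D%:Z%:~R : R) < m%:~R.
    by move: Dl; rewrite Em ltr_pM2r// ltrD2r.
  have : (m%:~R : R) <= (D%:Z + 1)%:~R.
    by rewrite intrD; move: Du; rewrite Em ler_pM2r// lerD2r.
  by rewrite ler_int ltr_int => h1 h2; lia.
have := floor_itv (N%:R / x - a); rewrite -xi => /andP[h1 h2].
have h3 : d%:R <= N%:R / x - a.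
  rewrite lerBrDr ler_pdivlMr//; apply: le_trans dl; rewrite ler_pM2l//.
  by have := ler0n R d; lra.
have h4 : N%:R / x - a <= D%:R + 1.
  rewrite lerBlDr ler_pdivrMr//; apply: le_trans Du _; rewrite ler_pM2l//.
  by have := ler0n R D; lra.
have : (d%:Z%:~R : R) < (i + 1)%:~R by apply: le_lt_trans h2.
rewrite ltr_int ltzD1 => h5.
have : (i%:~R : R) <= (D%:Z + 1)%:~R by rewrite intrD; apply: le_trans h4.
rewrite ler_int le_eqVlt => /orP[/eqP iE|]; last by rewrite ltzD1 h5.
(* digit [D + 1] could only occur at [x = a], where the digit is lowered *)
exfalso; move: h1; rewrite iE intrD => h1.
have NE : N%:R = (D%:R + 1 + a) * x.
  have : N%:R / x - a = D%:R + 1 by apply/eqP; rewrite eq_le h4.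
  by move=> /eqP; rewrite subr_eq => /eqP <-; field; rewrite gt_eqF.
have xE : x = a.
  apply/eqP; rewrite eq_le ax andbT -(ler_pM2l (_ : 0 < D%:R + 1 + a)) -?NE//.
  by have := ler0n R D; lra.
move: nint; rewrite xE eqxx /= => /negP; apply.
rewrite NE xE (_ : _ - a = (D%:Z + 1)%:~R) ?intr_int//.
by rewrite intrD; field; rewrite gt_eqF.
Qed.

Lemma int_itv_sub_image (d D : nat) (m : nat) : (D < d + m)%N ->
  [set i : int | d%:Z <= i <= D%:Z] `<=` (fun k : nat => (d + k)%:Z) @` `I_m.
Proof. move=> Dd i /= /andP[h1 h2]; exists (absz (i - d%:Z)) => /=; lia. Qed.

(** With [d] and [D] the extreme digits, the nonempty cylinders have indices
    between them, so five of them require [d + 4 <= D]; and [d] is positive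
    because [a + 1] is at most the square root of [N]. *)
Lemma cylinders_digit_bounds (R : realType) (N : nat) (a : R) : (2 <= N)%N -> 0 < a ->
  a <= Num.sqrt (N%:R : R) - 1 ->
  (`I_5 #<= [set i : int | cylinder N a i !=set0])%card ->
  exists d D, digit_bounds (N%:R : R) a d D.
Proof.
move=> N2 a0 aN hcyl.
have {}N2 : 2 <= N%:R :> R by rewrite (ler_nat _ 2).
have N0 : 0 < N%:R :> R by lra.
have sq : (a + 1) * (a + 1) <= N%:R.
  have := sqr_sqrtr (ltW N0); set r := Num.sqrt _ in aN * => <-; rewrite expr2; nra.
have x1 : 1 <= N%:R / (a + 1) - a by rewrite lerBrDr ler_pdivlMr; lra.
have x0 : 0 <= N%:R / (a + 1) - a by lra.
pose d := Num.truncn (N%:R / (a + 1) - a).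
have d1 : (1 <= d)%N by rewrite /d truncn_gt0.
have /andP[dl du] := truncn_itv x0; rewrite -/d -natr1 in dl du.
have {}dl : (d%:R + a) * (a + 1) <= N%:R by move: dl; rewrite lerBrDr ler_pdivlMr//; lra.
have {}du : N%:R < (d%:R + 1 + a) * (a + 1).
  by move: du; rewrite ltrBlDr ltr_pdivrMr//; lra.
have exD : exists D, N%:R <= (D%:R + 1 + a) * a.
  exists (Num.truncn (N%:R / a)).
  have := truncnS_gt (N%:R / a); rewrite -natr1 ltr_pdivrMr// => h.
  have := mulr_gt0 a0 a0; lra.
case: (ex_minnP exD) => D Du minD.
have Dl : (D%:R + a) * a < N%:R.
  case: D Du minD => [|D] Du minD; first by rewrite add0r; nra.
  by rewrite -natr1 ltNge; apply/negP => /minD; rewrite ltnn.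
exists d, D; split => //.
rewrite leqNgt; apply/negP => Dd.
have dD : (d <= D)%N.
  rewrite -ltnS -(ltr_nat R) -natr1; nra.
have sub : [set i : int | cylinder N a i !=set0] `<=` (fun k : nat => (d + k)%:Z) @` `I_4.
  apply: subset_trans (int_itv_sub_image Dd).
  by move=> i; exact: cylinder_digit_le dl Dl Du.
have : (`I_5 #<= `I_4)%card.
  apply: card_le_trans hcyl _; apply: card_le_trans (subset_card_le sub) _.
  exact: card_image_le.
by rewrite card_le_II.
Qed.

Theorem theorem4 (R : realType) (N : nat) (alpha : R)
  (hN : (2 <= N)%N)
  (halpha0 : 0 < alpha)
  (halpha : alpha <= Num.sqrt (N%:R : R) - 1)
  (hcyl : (`I_5 #<= [set i : int | cylinder N alpha i !=set0])%card) :
  forall a b : R, ~ is_gap N alpha a b.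
Proof.
move=> a b [ab abI ev _].
have [d [D bnd]] := cylinders_digit_bounds hN halpha0 halpha hcyl.
exact: not_eventually_avoided bnd a b ab abI ev.
Qed.
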